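(* Let $M$ be a five-dimensional contact manifold with a $G_2$ contact structure with spin bundle $S$, and for a scale $\sigma$ (a nowhere vanishing section of $\Lambda^2S=\Lambda^0[1]$) let $\nabla_{ABC}$ denote the associated preferred partial connection (defined in the context). Then the two first-order linear differential operators $$\textstyle S\to\bigodot^4S[-2],\quad \phi_D\mapsto\nabla_{(ABC}\phi_{D)},\qquad\text{and}\qquad S[-\tfrac43]\to\bigodot^2S[-\tfrac73],\quad \phi_C\mapsto\nabla_{AB}{}^C\phi_C,$$ are independent of the choice of scale $\sigma$; that is, they are defined only in terms of the $G_2$ contact structure.
   Context: Everything is smooth and real. $M$ is a 5-manifold with contact distribution $H\subset TM$ (rank 4), $L\subset\Lambda^1$ is the annihilator of $H$, $\Lambda^k_H=\Lambda^kH^*$. The Levi form is the injective bundle map $L\to\Lambda^2_H$, $\alpha\mapsto d\alpha|_H$. Write $\Lambda^2_H=\Lambda^2_{H\perp}\oplus L$, where $\Lambda^2_{H\perp}$ consists of forms trace-free with respect to the Levi form. The Rumin operator $d_\perp:\Lambda^1_H\to\Lambda^2_{H\perp}$ is: lift $\omega$ to a 1-form $\tilde\omega$ on $M$ and project $d\tilde\omega|_H$ to $\Lambda^2_{H\perp}$. A partial connection on a vector bundle $V$ is a linear differential operator $\nabla_H:V\to\Lambda^1_H\otimes V$ with $\nabla_H(fs)=f\nabla_Hs+(df|_H)\otimes s$. The partial torsion of a partial connection on $\Lambda^1_H$ is the homomorphism $\nabla_\perp-d_\perp:\Lambda^1_H\to\Lambda^2_{H\perp}$, where $\nabla_\perp$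 is $\nabla_H$ followed by $\Lambda^1_H\otimes\Lambda^1_H\to\Lambda^2_H\to\Lambda^2_{H\perp}$. A $G_2$ contact structure on $M$ is a rank 2 bundle $S$ with an isomorphism $\bigodot^3S\cong\Lambda^1_H[2]$, where densities $\Lambda^0[w]$ are normalised by $\Lambda^5=\Lambda^0[-3]$ and $V[w]=V\otimes\Lambda^0[w]$, which is Levi-compatible: the Levi form $L[4]\to\Lambda^2_H[4]=\Lambda^2(\bigodot^3S)=(\bigodot^4S\otimes\Lambda^2S)\oplus(\Lambda^2S)^3$ has its range in the second summand. It follows that canonically $\Lambda^2S=\Lambda^0[1]$, $L=\Lambda^0[-1]$, $\Lambda^1_H=\bigodot^3S[-2]$, $\Lambda^2_{H\perp}=\bigodot^4S[-3]$. The line bundle $\Lambda^2S$ is taken to be oriented so that real powers $\Lambda^0[w]=(\Lambda^2S)^w$ make sense. Preferred partial connection: for a scale $\sigma$ there is a unique partial connection on $S$ such that the induced partial connection on $\Lambda^2S$ annihilates $\sigma$ and such that the partial torsion of the induced partial connection on $\Lambda^1_H$ lies in the $\bigodot^7S[-4]$ summand of $\mathrm{Hom}(\Lambda^1_H,\Lambda^2_{H\perp})=\bigodot^7S[-4]\oplus\bigodot^5S[-3]\oplus\bigodot^3S[-2]\oplus S[-1]$. It is written $\phi_D\mapsto\nabla_{ABC}\phi_D=\nabla_{(ABC)}\phi_D$, the indices $ABC$ referring to $\Lambda^1_H=\bigodot^3S[-2]$, and is extended to the bundles $S[w]$ by the Leibniz rule. Round brackets denote symmetrisation; $\nabla_{AB}{}^C\phi_C$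 denotes the image of $\nabla_{ABC}\phi_D$ under the natural contraction $\bigodot^3S\otimes S\to\bigodot^2S\otimes\Lambda^2S=\bigodot^2S[1]$. *)

(* Defs.v *)
(* MathComp-Analysis; the real numbers are an arbitrary R : realType. *)
From HB Require Import structures.
From mathcomp Require Import all_boot all_order all_algebra all_fingroup.
From mathcomp Require Import all_classical all_reals all_analysis.

Set Implicit Arguments.
Unset Strict Implicit.
Unset Printing Implicit Defensive.

Import Order.TTheory GRing.Theory Num.Theory numFieldNormedType.Exports.

Local Open Scope classical_set_scope.
Local Open Scope ring_scope.

(** * Smooth 5-manifolds *)

(* C^k functions on an open subset U of R^5; values outside U are irrelevant. *)
Fixpoint Ck (R : realType) (k : nat) (U : set 'rV[R]_5) (f : 'rV[R]_5 -> R)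
    : Prop :=
  if k is k'.+1 then
    (forall p, U p -> differentiable f p) /\
    (forall v, Ck k' U (fun p => 'D_v f p))
  else forall p, U p -> {for p, continuous f}.

Definition smooth_Rn (R : realType) (U : set 'rV[R]_5) (f : 'rV[R]_5 -> R) :=
  forall k, Ck k U f.

(* [coord i] is a homeomorphism from the open set [dom i] onto an open subset
   of R^5, with inverse [param i]; [chart_at x] is some chart around x. *)
Record manifold5 (R : realType) := Manifold5 {
  points :> topologicalType;
  chart : Type;
  dom : chart -> set points;
  coord : chart -> points -> 'rV[R]_5;
  param : chart -> 'rV[R]_5 -> points;
  chart_at : points -> chart;
  points_hausdorff : hausdorff_space points;
  points_second_countable : @second_countable points;
  dom_open : forall i, open (dom i);
  img_open : forall i, open (coord i @` dom i);
  coordK : forall i x, dom i x -> param i (coord i x) = x;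
  coord_cts : forall i x, dom i x -> {for x, continuous (coord i)};
  param_cts : forall i p, (coord i @` dom i) p -> {for p, continuous (param i)};
  chart_atP : forall x, dom (chart_at x) x;
  transition_smooth : forall i i' (a : 'I_5),
    smooth_Rn (coord i @` (dom i `&` dom i'))
              (fun p => coord i' (param i p) 0 a) }.

Arguments dom {R m}.
Arguments coord {R m}.
Arguments param {R m}.
Arguments chart_at {R m}.

Definition smooth_on (R : realType) (M : manifold5 R) (W : set M) (f : M -> R) :=
  forall i, smooth_Rn (coord i @` (dom i `&` W)) (f \o param i).

Definition pd (R : realType) (M : manifold5 R) (i : chart M) (a : 'I_5)
    (f : M -> R) (x : M) : R :=
  'D_(delta_mx 0 a) (f \o param i) (coord i x).

(* jac i i' x a b = d x_{i'}^b / d x_i^a.  A tangent vector with components v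
   in the chart i has components v *m jac i i' x in the chart i'. *)
Definition jac (R : realType) (M : manifold5 R) (i i' : chart M) (x : M)
    : 'M[R]_5 :=
  \matrix_(a, b) pd i a (fun y => coord i' y 0 b) x.

Definition ev (R : realType) (al v : 'rV[R]_5) : R := \sum_a al 0 a * v 0 a.

(* A smooth 1-form on an open subset W of the domain of the chart i, given by
   its components in that chart. *)
Definition local_form (R : realType) (M : manifold5 R) (i : chart M)
    (W : set M) (al : M -> 'rV[R]_5) :=
  [/\ open W, W `<=` dom i & forall a, smooth_on W (fun y => al y 0 a)].

(* The value (d al)_x(u, v), for u and v tangent vectors at x. *)
Definition dform (R : realType) (M : manifold5 R) (i : chart M)
    (al : M -> 'rV[R]_5) (x : M) (u v : 'rV[R]_5) : R :=
  \sum_a \sum_b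
    u 0 a * v 0 b * (pd i a (fun y => al y 0 b) x - pd i b (fun y => al y 0 a) x).

(** * Contact distributions *)

(* [ctH i x] is the subspace H_x of T_x M in the components of the chart i. *)
Record contact (R : realType) (M : manifold5 R) := Contact {
  ctH : chart M -> M -> set 'rV[R]_5;
  ctH_chart : forall i i' x, dom i x -> dom i' x ->
    forall v, ctH i x v <-> ctH i' x (v *m jac i i' x);
  ctH_contact : forall i x, dom i x -> exists W (al : M -> 'rV[R]_5),
    [/\ local_form i W al, W x &
        forall y, W y ->
        [/\ al y != 0,
            forall v, ctH i y v <-> ev (al y) v = 0 &
            forall u, ctH i y u -> u != 0 ->
              exists2 v, ctH i y v & dform i al y u v != 0]] }.

Arguments ctH {R M}.

Definition L_section (R : realType) (M : manifold5 R) (H : contact M)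
    (i : chart M) (W : set M) (al : M -> 'rV[R]_5) :=
  local_form i W al /\
  forall y, W y -> forall v, ctH H i y v -> ev (al y) v = 0.

(** * Oriented rank 2 bundles and their weighted tensor bundles *)

(* S is presented by local frames (s^0, s^1), indexed by [frame] and all
   positively oriented, and by their transition matrices: the components
   of phi = phi_0 s^0 + phi_1 s^1 transform by phi_j = (trans j j') phi_j'. *)
Record spin_bundle (R : realType) (M : manifold5 R) := SpinBundle {
  frame : Type;
  fdom : frame -> set M;
  trans : frame -> frame -> M -> 'M[R]_2;
  fdom_open : forall j, open (fdom j);
  fdom_cover : forall x, exists j, fdom j x;
  trans_smooth : forall j j' a b,
    smooth_on (fdom j `&` fdom j') (fun x => trans j j' x a b);
  trans_id : forall j x, fdom j x -> trans j j x = 1%:M;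
  trans_cocycle : forall j j' j'' x, fdom j x -> fdom j' x -> fdom j'' x ->
    trans j j' x *m trans j' j'' x = trans j j'' x;
  trans_oriented : forall j j' x, fdom j x -> fdom j' x ->
    0 < \det (trans j j' x) }.

Arguments fdom {R M s}.
Arguments trans {R M s}.

(* Components T_{A...D} with k lower spinor indices. *)
Definition spinor (R : realType) (k : nat) := k.-tuple 'I_2 -> R.

(* Reindexing of t by a permutation of its k slots. *)
Definition slot_perm (k : nat) (t : k.-tuple 'I_2) (p : 'S_k) : k.-tuple 'I_2 :=
  [tuple tnth t (p a) | a < k].

Definition slot_symmetric (V : Type) (k : nat) (T : k.-tuple 'I_2 -> V) :=
  forall t p, T (slot_perm t p) = T t.

(* T_{(A...D)} *)
Definition symmetrise (R : realType) (k : nat) (T : spinor R k) : spinor R k :=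
  fun t => (k`!%:R)^-1 * \sum_(p : 'S_k) T (slot_perm t p).

Definition trans_coef (R : realType) (M : manifold5 R) (S : spin_bundle M)
    (j j' : frame S) (x : M) (k : nat) (t u : k.-tuple 'I_2) : R :=
  \prod_(a < k) trans j j' x (tnth t a) (tnth u a).

(* A smooth section over W of the k-th tensor power of S, tensored with
   Lambda^0[w], where Lambda^0[w] is the w-th power of Lambda^2 S: a family of
   components in all the frames.  For k = 0, w = 1 this is a section of
   Lambda^2 S, with component f_j for f_j s^0 /\ s^1. *)
Definition tensor_section (R : realType) (M : manifold5 R) (S : spin_bundle M)
    (k : nat) (w : R) (W : set M) (psi : frame S -> M -> spinor R k) :=
  (forall j t, smooth_on (W `&` fdom j) (fun x => psi j x t)) /\
  (forall j j' x, W x -> fdom j x -> fdom j' x -> forall t,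
     psi j x t = (\det (trans j j' x)) `^ w *
                 \sum_u trans_coef j j' x t u * psi j' x u).

(* The invariant skew spinor, with eps 0 1 = 1. *)
Definition eps (R : realType) (A B : 'I_2) : R :=
  ((A < B)%N : nat)%:R - ((B < A)%N : nat)%:R.

(* The generator of (Lambda^2 S)^3 in Lambda^2 (Sym^3 S): the symmetrisation
   over ABC (equivalently DEF) of eps_{AD} eps_{BE} eps_{CF}. *)
Definition eps3 (R : realType) (s t : 3.-tuple 'I_2) : R :=
  (3`!%:R)^-1 *
  \sum_(p : 'S_3) \prod_(a < 3) eps R (tnth s a) (tnth (slot_perm t p) a).

(** * G2 contact structures *)

Definition t000 : 3.-tuple 'I_2 := [tuple of [:: 0; 0; 0]].
Definition t001 : 3.-tuple 'I_2 := [tuple of [:: 0; 0; 1]].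
Definition t011 : 3.-tuple 'I_2 := [tuple of [:: 0; 1; 1]].
Definition t111 : 3.-tuple 'I_2 := [tuple of [:: 1; 1; 1]].

(* The isomorphism Lambda^1_H[2] -> Sym^3 S is omega |-> omega(g2Y_{ABC}), for
   vectors g2Y_{ABC} in H (x) Lambda^0[-2].  Here Lambda^0[w] is the power -w/3
   of Lambda^5, trivialised by the coordinate volume form dx^1 /\ ... /\ dx^5
   of the chart i; whence the power 2/3 of the Jacobian in [g2Y_chart].
   [g2Y_surj] and [g2Y_inj] say that the map is onto Sym^3 S and injective on
   Lambda^1_H = Lambda^1 / L. *)
Record g2_contact (R : realType) (M : manifold5 R) (H : contact M)
    (S : spin_bundle M) := G2Contact {
  g2Y : chart M -> frame S -> M -> 3.-tuple 'I_2 -> 'rV[R]_5;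
  g2Y_smooth : forall i j t a,
    smooth_on (dom i `&` fdom j) (fun x => g2Y i j x t 0 a);
  g2Y_sym : forall i j x, dom i x -> fdom j x -> slot_symmetric (g2Y i j x);
  g2Y_H : forall i j x t, dom i x -> fdom j x -> ctH H i x (g2Y i j x t);
  g2Y_surj : forall i j x, dom i x -> fdom j x ->
    forall psi : spinor R 3, slot_symmetric psi ->
      exists om, forall t, ev om (g2Y i j x t) = psi t;
  g2Y_inj : forall i j x, dom i x -> fdom j x ->
    forall om, (forall t, ev om (g2Y i j x t) = 0) ->
      forall v, ctH H i x v -> ev om v = 0;
  g2Y_chart : forall i i' j x t, dom i x -> dom i' x -> fdom j x ->
    g2Y i' j x t =
      (`|\det (jac i' i x)| `^ (2 / 3)) *: (g2Y i j x t *m jac i i' x);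
  g2Y_frame : forall i j j' x t, dom i x -> fdom j x -> fdom j' x ->
    g2Y i j x t = \sum_u trans_coef j j' x t u *: g2Y i j' x u;
  g2Y_Levi : forall i j W al x,
    L_section H i W al -> W x -> fdom j x ->
    exists lam : R, forall s t,
      dform i al x (g2Y i j x s) (g2Y i j x t) = lam * eps3 R s t }.

(* The canonical identification Lambda^2 S = Lambda^0[1], given by its
   component kap: s^0 /\ s^1 = kap i j times the power -1/3 of
   dx^1 /\ ... /\ dx^5.  It is obtained from the Levi isomorphism
   L[4] = (Lambda^2 S)^3 and from
   Lambda^5 = L (x) Lambda^4_H, Lambda^4_H[8] = Lambda^4 (Sym^3 S) = (Lambda^2 S)^6,
   which together give (Lambda^2 S)^9 = Lambda^0[9].  This determines kap. *)
Definition density_iso (R : realType) (M : manifold5 R) (H : contact M)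
    (S : spin_bundle M) (G : g2_contact H S) (kap : chart M -> frame S -> M -> R) :=
  forall i j W al x (lam : R), L_section H i W al -> W x -> fdom j x ->
    (forall s t, dform i al x (g2Y G i j x s) (g2Y G i j x t) = lam * eps3 R s t) ->
    forall v : 'rV[R]_5,
      ev (al x) v =
      kap i j x ^+ 9 * lam *
      \det (\matrix_(r < 5) tnth [tuple v; g2Y G i j x t000; g2Y G i j x t001;
                                        g2Y G i j x t011; g2Y G i j x t111] r).

(* The resulting isomorphism Lambda^1_H -> Sym^3 S[-2], where now
   Lambda^0[w] = (Lambda^2 S)^w, is omega |-> omega_{ABC} = omega(g2X_{ABC}). *)
Definition g2X (R : realType) (M : manifold5 R) (H : contact M)
    (S : spin_bundle M) (G : g2_contact H S) (kap : chart M -> frame S -> M -> R)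
    (i : chart M) (j : frame S) (x : M) (t : 3.-tuple 'I_2) : 'rV[R]_5 :=
  kap i j x ^+ 2 *: g2Y G i j x t.

(* (df|_H)_{ABC} *)
Definition dH (R : realType) (M : manifold5 R) (H : contact M)
    (S : spin_bundle M) (G : g2_contact H S) (kap : chart M -> frame S -> M -> R)
    (j : frame S) (f : M -> R) (x : M) (s : 3.-tuple 'I_2) : R :=
  \sum_a pd (chart_at x) a f x * g2X G kap (chart_at x) j x s 0 a.

(** * Partial connections *)

(* A differential operator is local: it acts on sections over every open set,
   compatibly with restriction.  This is encoded by a single map on families of
   components whose values on W depend only on the argument on W.  The value
   nab phi j x [A;B;C;D] is nabla_{ABC} phi_D, a section of
   Sym^3 S[-2] (x) S = Lambda^1_H (x) S. *)
Record partial_connection (R : realType) (M : manifold5 R) (H : contact M)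
    (S : spin_bundle M) (G : g2_contact H S) (kap : chart M -> frame S -> M -> R)
    (nab : (frame S -> M -> spinor R 1) -> frame S -> M -> spinor R 4) : Prop :=
  PartialConnection {
  pc_section : forall W phi, open W -> tensor_section 0 W phi ->
    tensor_section (- 2) W (nab phi);
  pc_sym : forall W phi, open W -> tensor_section 0 W phi ->
    forall j x, W x -> fdom j x -> forall t : 1.-tuple 'I_2,
      slot_symmetric (fun s : 3.-tuple 'I_2 => nab phi j x [tuple of s ++ t]);
  pc_local : forall W phi phi', open W ->
    tensor_section 0 W phi -> tensor_section 0 W phi' ->
    (forall j x, W x -> fdom j x -> forall t, phi j x t = phi' j x t) ->
    forall j x, W x -> fdom j x -> forall u, nab phi j x u = nab phi' j x u;
  pc_linear : forall W phi phi' (c : R), open W ->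
    tensor_section 0 W phi -> tensor_section 0 W phi' ->
    forall j x, W x -> fdom j x -> forall u,
      nab (fun j y t => c * phi j y t + phi' j y t) j x u =
      c * nab phi j x u + nab phi' j x u;
  pc_Leibniz : forall W phi f, open W ->
    tensor_section 0 W phi -> smooth_on W f ->
    forall j x, W x -> fdom j x ->
    forall (s : 3.-tuple 'I_2) (t : 1.-tuple 'I_2),
      nab (fun j y t => f y * phi j y t) j x [tuple of s ++ t] =
      f x * nab phi j x [tuple of s ++ t] + dH G kap j f x s * phi j x t }.

(* The frame section s^E of S over [fdom j], in the components of all frames. *)
Definition frame_section (R : realType) (M : manifold5 R) (S : spin_bundle M)
    (j : frame S) (E : 'I_2) : frame S -> M -> spinor R 1 :=
  fun j' x t => trans j' j x (tnth t 0) E.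

(* nabla_{ABC} s^E = Gamma_{ABC D}^E s^D *)
Definition Gamma (R : realType) (M : manifold5 R) (S : spin_bundle M)
    (nab : (frame S -> M -> spinor R 1) -> frame S -> M -> spinor R 4)
    (j : frame S) (x : M) (s : 3.-tuple 'I_2) (D E : 'I_2) : R :=
  nab (frame_section j E) j x [tuple of s ++ [tuple D]].

Definition set_slot (k : nat) (t : k.-tuple 'I_2) (a : 'I_k) (E : 'I_2)
    : k.-tuple 'I_2 :=
  [tuple if b == a then E else tnth t b | b < k].

(* The partial connection induced by nab on the k-th tensor power of S with
   weight w.  By the Leibniz rule, in the frame j it is
     (d psi_{D...F}|_H)_{ABC} + Gamma_{ABC D}^E psi_{E...F} + ...
       + Gamma_{ABC F}^E psi_{D...E} + w Gamma_{ABC E}^E psi_{D...F},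
   the last term because nabla_{ABC} (s^0 /\ s^1) = Gamma_{ABC E}^E s^0 /\ s^1. *)
Definition induced (R : realType) (M : manifold5 R) (H : contact M)
    (S : spin_bundle M) (G : g2_contact H S) (kap : chart M -> frame S -> M -> R)
    (nab : (frame S -> M -> spinor R 1) -> frame S -> M -> spinor R 4)
    (k : nat) (w : R) (psi : frame S -> M -> spinor R k)
    (j : frame S) (x : M) (s : 3.-tuple 'I_2) (t : k.-tuple 'I_2) : R :=
  dH G kap j (fun y => psi j y t) x s
  + \sum_(a < k) \sum_E Gamma nab j x s (tnth t a) E * psi j x (set_slot t a E)
  + w * (\sum_E Gamma nab j x s E E) * psi j x t.

(** * Partial torsion *)

(* The projection of Lambda^2_H onto its subspace Lambda^2_{H perp} of forms
   that are trace-free with respect to the Levi form, the latter being a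
   multiple of eps3. *)
Definition trace_Levi (R : realType) (be : 3.-tuple 'I_2 -> 3.-tuple 'I_2 -> R)
    : R :=
  \sum_s \sum_t eps3 R s t * be s t.

Definition perp (R : realType) (be : 3.-tuple 'I_2 -> 3.-tuple 'I_2 -> R)
    (s t : 3.-tuple 'I_2) : R :=
  be s t - trace_Levi be / trace_Levi (@eps3 R) * eps3 R s t.

(* The isomorphism Sym^4 S[-3] -> Lambda^2_{H perp}: symmetrise
   psi_{ABDE} eps_{CF} over ABC and over DEF. *)
Definition sym4_perp (R : realType) (psi : spinor R 4) (s t : 3.-tuple 'I_2) : R :=
  (3`!%:R)^-1 ^+ 2 * \sum_(p : 'S_3) \sum_(q : 'S_3)
    let s' := slot_perm s p in let t' := slot_perm t q in
    psi [tuple tnth s' 0; tnth s' 1; tnth t' 0; tnth t' 1]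
    * eps R (tnth s' 2%:R) (tnth t' 2%:R).

(* tau_{ABDE PQR} omega^{PQR}, with indices raised by eps: the homomorphism
   Sym^3 S[-2] -> Sym^4 S[-3] given by tau in Sym^7 S[-4]. *)
Definition contract7 (R : realType) (tau : spinor R 7) (om : spinor R 3)
    : spinor R 4 :=
  fun u => \sum_(v : 3.-tuple 'I_2) \sum_(r : 3.-tuple 'I_2)
    tau [tuple of u ++ v] * (\prod_(a < 3) eps R (tnth v a) (tnth r a)) * om r.

(* The components omega_{ABC} of the restriction to H of a local 1-form. *)
Definition restrictH (R : realType) (M : manifold5 R) (H : contact M)
    (S : spin_bundle M) (G : g2_contact H S) (kap : chart M -> frame S -> M -> R)
    (i : chart M) (om : M -> 'rV[R]_5) : frame S -> M -> spinor R 3 :=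
  fun j x t => ev (om x) (g2X G kap i j x t).

(* The skew part of the induced partial connection on Lambda^1_H = Sym^3 S[-2]
   is normalised as for d: (d omega)(X,Y) = X omega(Y) - Y omega(X) - ... *)
Definition nabla_perp (R : realType) (M : manifold5 R) (H : contact M)
    (S : spin_bundle M) (G : g2_contact H S) (kap : chart M -> frame S -> M -> R)
    (nab : (frame S -> M -> spinor R 1) -> frame S -> M -> spinor R 4)
    (om : frame S -> M -> spinor R 3) (j : frame S) (x : M)
    : 3.-tuple 'I_2 -> 3.-tuple 'I_2 -> R :=
  perp (fun s t => induced G kap nab (- 2) om j x s t
                   - induced G kap nab (- 2) om j x t s).

(* The Rumin operator applied to the restriction to H of om. *)
Definition d_perp (R : realType) (M : manifold5 R) (H : contact M)
    (S : spin_bundle M) (G : g2_contact H S) (kap : chart M -> frame S -> M -> R)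
    (i : chart M) (om : M -> 'rV[R]_5) (j : frame S) (x : M)
    : 3.-tuple 'I_2 -> 3.-tuple 'I_2 -> R :=
  perp (fun s t => dform i om x (g2X G kap i j x s) (g2X G kap i j x t)).

Definition torsion_in_Sym7 (R : realType) (M : manifold5 R) (H : contact M)
    (S : spin_bundle M) (G : g2_contact H S) (kap : chart M -> frame S -> M -> R)
    (nab : (frame S -> M -> spinor R 1) -> frame S -> M -> spinor R 4) :=
  forall i j x, dom i x -> fdom j x ->
  exists2 tau : spinor R 7, slot_symmetric tau &
    forall W om, local_form i W om -> W x -> forall s t,
      nabla_perp G kap nab (restrictH G kap i om) j x s t
      - d_perp G kap i om j x s t =
      sym4_perp (contract7 tau (restrictH G kap i om j x)) s t.

(** * Scales and preferred partial connections *)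

Definition is_scale (R : realType) (M : manifold5 R) (S : spin_bundle M)
    (sg : frame S -> M -> spinor R 0) :=
  tensor_section 1 setT sg /\
  forall j x t, fdom j x -> sg j x t != 0.

Definition preferred (R : realType) (M : manifold5 R) (H : contact M)
    (S : spin_bundle M) (G : g2_contact H S) (kap : chart M -> frame S -> M -> R)
    (sg : frame S -> M -> spinor R 0)
    (nab : (frame S -> M -> spinor R 1) -> frame S -> M -> spinor R 4) :=
  [/\ partial_connection G kap nab,
      forall j x s t, fdom j x -> induced G kap nab 1 sg j x s t = 0 &
      torsion_in_Sym7 G kap nab].

(** * The two operators *)

(* phi_D |-> nabla_{(ABC} phi_{D)} on S *)
Definition twistor_op (R : realType) (M : manifold5 R) (S : spin_bundle M)
    (nab : (frame S -> M -> spinor R 1) -> frame S -> M -> spinor R 4)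
    (phi : frame S -> M -> spinor R 1) (j : frame S) (x : M) : spinor R 4 :=
  symmetrise (nab phi j x).

(* phi_C |-> nabla_{AB}^C phi_C on S[w]: the contraction
   Sym^3 S (x) S -> Sym^2 S (x) Lambda^2 S takes the component along
   s^0 /\ s^1 of the skew part in the last two indices. *)
Definition dirac_op (R : realType) (M : manifold5 R) (H : contact M)
    (S : spin_bundle M) (G : g2_contact H S) (kap : chart M -> frame S -> M -> R)
    (nab : (frame S -> M -> spinor R 1) -> frame S -> M -> spinor R 4) (w : R)
    (phi : frame S -> M -> spinor R 1) (j : frame S) (x : M) : spinor R 2 :=
  fun t => \sum_C \sum_D eps R C D *
    induced G kap nab w phi j x [tuple tnth t 0; tnth t 1; C] [tuple D].

(* Main.v *)
Require Import Defs.
From HB Require Import structures.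
From mathcomp Require Import all_boot all_order all_algebra all_fingroup.
From mathcomp Require Import all_classical all_reals all_analysis.
From mathcomp Require Import ring lra.
Import Order.TTheory GRing.Theory Num.Theory numFieldNormedType.Exports.
(* Gives back to dom its meaning as the domain of a chart. *)
Import Defs.
Local Open Scope classical_set_scope.
Local Open Scope ring_scope.

Set Implicit Arguments.
Unset Strict Implicit.
Unset Printing Implicit Defensive.

(** Two preferred partial connections on S differ by a tensor
<<
  delta_{ABC D}^E = delta_{(ABC) D}^E,
>>
a section of Sym^3 S[-2] (x) End S.  The whole theorem is the determination of
delta from the torsion condition.  The difference of the two partial torsions is
linear over functions in delta, being omega |-> the trace-free part of the skew
part of the action of delta on Sym^3 S[-2], and it lies in Sym^7 S[-4]
([torsion_sub]).  Now delta takes values in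
<<
  Sym^3 (x) (Sym^2 + Sym^0) = Sym^5 + Sym^3 + Sym^1 + Sym^3
>>
up to weights, whereas the torsion has components in Sym^7, Sym^5, Sym^3 and
Sym^1.  The vanishing of the last three leaves only one copy of Sym^3, so that
delta is determined by its trace Y_{ABC} = delta_{ABC E}^E.  Explicitly
([connection_change])
<<
  delta_{ABC D}^E = Y_{(AB}^E eps_{C)D},   Y_{AB}^E = sum_F Y_{ABF} eps_{FE}.
>>
Both operators are read off from this formula.  Symmetrising over ABCD kills
eps_{CD}, so nabla_{(ABC} phi_{D)} does not change ([twistor_change]).
Contracting C with D gives 4/3 Y_{AB}^E phi_E, and the weight w contributes
w Y_{AB}^E phi_E, so that nabla_{AB}^C phi_C does not change when w = -4/3
([dirac_change]).

The determination of delta is done in components.  The tensors being symmetric,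
their components depend only on how many indices are equal to 1; the torsion
condition becomes twenty linear equations ([torsion_equations]) in the sixteen
components of delta and the eight components of the Sym^7 part, which are solved
weight by weight under the diagonal torus of GL_2 ([weight_solution]).

On the analytic side, the Leibniz rule and locality express nabla by its
coefficients in a local frame ([partial_connection_frame]), and the torsion
condition, imposed on all local 1-forms, is used only on forms with constant
coefficients in a chart: these already take all values at a given point
([restrictH_onto]). *)

Local Notation ones := (count_mem (1%R : 'I_2)).

(** * Smooth functions *)

(** Differentiability is a property of the germ: f and g have the same expansion
    f (h + a) = f a + 'd f a h + o(h). *)
Lemma near_eq_differentiable (R : realType) (V W : normedModType R)
    (f g : V -> W) (a : V) :
  {near a, f =1 g} -> differentiable f a -> differentiable g a.
Proof.
move=> fg /diff_locallyP[cdf dfE].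
have ga : g a = f a by rewrite (nbhs_singleton fg).
have dgE : g \o shift a = cst (g a) + 'd f a +o_ (0 : V) id.
  rewrite ga; apply/eqaddoP => _/posnumP[e].
  move/eqaddoP: dfE => /(_ e%:num (gt0 e)) dfE.
  have fg0 : \forall h \near (0 : V), f (h + a) = g (h + a).
    have /= := fg; rewrite /prop_near1 nbhs_nearE (near_shift (0 : V) a) /=.
    by rewrite /shift /= subr0.
  near=> h; have fgh : f (h + a) = g (h + a) by near: h.
  suff -> : (g \o shift a - (cst (f a) + 'd f a)) h =
            (f \o shift a - (cst (f a) + 'd f a)) h by near: h.
  by rewrite !fctE /= fgh.
have dgf := diff_unique cdf dgE.
by apply/diff_locallyP; rewrite dgf.
Unshelve. all: by end_near. Qed.

Section Ck.
Variables (R : realType) (U : set 'rV[R]_5).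

Lemma Ck_sub k (U' : set 'rV[R]_5) f : U' `<=` U -> Ck k U f -> Ck k U' f.
Proof.
move=> sU; elim: k f => [|k IHk] f /=; first by move=> cf p /sU /cf.
by move=> [df Df]; split=> [p /sU /df //|v]; apply/IHk/Df.
Qed.

Hypothesis openU : open U.

(** The values outside U are irrelevant: this is what allows the pointwise rules
    for the derivative of a sum or a product to be iterated. *)
Lemma Ck_ext k f g : (forall p, U p -> f p = g p) -> Ck k U f -> Ck k U g.
Proof.
elim: k f g => [|k IHk] f g fg /=.
all: have nfg p : U p -> \forall q \near p, f q = g q
  by move=> Up; apply: filterS (open_nbhs_nbhs (conj openU Up)) => q; exact: fg.
  move=> cf p Up; rewrite /prop_for /continuous_at -(fg p Up).
  exact: cvg_trans (near_eq_cvg (nfg p Up)) (cf p Up).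
move=> [df Df]; split=> [p Up|v].
  exact: near_eq_differentiable (nfg p Up) (df p Up).
by apply: IHk (Df v) => p Up; apply: near_eq_derive; exact: nfg.
Qed.

Lemma CkSW k f : Ck k.+1 U f -> Ck k U f.
Proof.
elim: k f => [|k IHk] f [df Df].
  by move=> p Up; apply: differentiable_continuous; exact: df.
by split=> // v; apply/IHk/Df.
Qed.

Lemma CkD k f g : Ck k U f -> Ck k U g -> Ck k U (fun p => f p + g p).
Proof.
elim: k f g => [|k IHk] f g.
  by move=> cf cg p Up; exact: (cvgD (cf p Up) (cg p Up)).
move=> [df Df] [dg Dg]; split=> [p Up|v].
  by apply: differentiableD; [exact: df|exact: dg].
apply: Ck_ext (IHk _ _ (Df v) (Dg v)) => p Up.
by rewrite -deriveD //; apply: diff_derivable; [exact: df|exact: dg].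
Qed.

Lemma CkM k f g : Ck k U f -> Ck k U g -> Ck k U (fun p => f p * g p).
Proof.
elim: k f g => [|k IHk] f g.
  by move=> cf cg p Up; exact: (cvgM (cf p Up) (cg p Up)).
move=> kf kg; have [df Df] := kf; have [dg Dg] := kg; split=> [p Up|v].
  by apply: differentiableM; [exact: df|exact: dg].
have kfDg := IHk _ _ (CkSW kf) (Dg v).
have kgDf := IHk _ _ (CkSW kg) (Df v).
apply: Ck_ext (CkD kfDg kgDf) => p Up.
by rewrite deriveM //; apply: diff_derivable; [exact: df|exact: dg].
Qed.

End Ck.

Lemma Ck_cst (R : realType) k (U : set 'rV[R]_5) (c : R) : Ck k U (fun=> c).
Proof.
elim: k c => [|k IHk] c; first by move=> p _; exact: cst_continuous.
split=> [p _|v]; first exact: differentiable_cst.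
by have -> : (fun p => 'D_v (fun=> c) p) = fun=> 0
  by apply/funext => p; exact: derive_cst.
Qed.

Section smooth_on.
Variables (R : realType) (M : manifold5 R).

Lemma open_coord_image (i : chart M) (W : set M) :
  open W -> open (coord i @` (dom i `&` W)).
Proof.
move=> oW.
have -> : coord i @` (dom i `&` W) = coord i @` dom i `&` param i @^-1` W.
  apply/seteqP; split=> [_ [y [iy Wy] <-]|_ [[y iy <-]]].
    by split; [exists y|rewrite /= coordK].
  by rewrite /= coordK // => Wy; exists y.
rewrite openE => p [ip Wp].
have Ip : nbhs p (coord i @` dom i)
  by apply: open_nbhs_nbhs; split=> //; exact: img_open.
have Jp : nbhs p (param i @^-1` W)
  by apply: (param_cts ip); apply: open_nbhs_nbhs.
exact: filterI Ip Jp.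
Qed.

Lemma smooth_on_sub (W W' : set M) (f : M -> R) :
  W' `<=` W -> smooth_on W f -> smooth_on W' f.
Proof.
move=> sW sf i k; apply: Ck_sub (sf i k) => _ [y [iy Wy] <-].
by exists y => //; split=> //; exact: sW.
Qed.

Lemma smooth_on_ext (W : set M) (f g : M -> R) : open W ->
  (forall x, W x -> f x = g x) -> smooth_on W f -> smooth_on W g.
Proof.
move=> oW fg sf i k; apply: Ck_ext (sf i k); first exact: open_coord_image.
by move=> _ [y [iy Wy] <-] /=; rewrite coordK // fg.
Qed.

Lemma smooth_onM (W : set M) (f g : M -> R) : open W ->
  smooth_on W f -> smooth_on W g -> smooth_on W (fun x => f x * g x).
Proof.
move=> oW sf sg i k.
by apply: CkM; [exact: open_coord_image|exact: sf|exact: sg].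
Qed.

Lemma smooth_on_cst (W : set M) (c : R) : smooth_on W (fun=> c).
Proof. by move=> i k; exact: Ck_cst. Qed.

End smooth_on.

(** * Tuples of spinor indices *)

Lemma ord2P (P : 'I_2 -> Prop) : P 0 -> P 1 -> forall E, P E.
Proof.
by move=> P0 P1 -[[|[|//]] lt2];
  [move: P0|move: P1]; congr P; exact: val_inj.
Qed.

Lemma sum2 (V : nmodType) (F : 'I_2 -> V) : \sum_E F E = F 0 + F 1.
Proof. by rewrite big_ord_recl big_ord1; congr (_ + F _); exact: val_inj. Qed.

Lemma sum3 (V : nmodType) (F : 'I_3 -> V) : \sum_a F a = F 0 + F 1 + F 2%:R.
Proof.
rewrite !big_ord_recl big_ord0 /= addr0 addrA.
by congr (F _ + F _ + F _); exact: val_inj.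
Qed.

Lemma tuple1_eta (T : Type) (t : 1.-tuple T) : [tuple tnth t 0] = t.
Proof. by apply: eq_from_tnth => a; rewrite [a]ord1. Qed.

Lemma tuple3_eta (v : 3.-tuple 'I_2) :
  v = [tuple tnth v 0; tnth v 1; tnth v 2%:R].
Proof.
by apply: eq_from_tnth => -[[|[|[|//]]] i]; rewrite [RHS](tnth_nth 0) /=;
  congr tnth; exact: val_inj.
Qed.

Lemma set_slot3 (a b c E : 'I_2) :
  (set_slot [tuple a; b; c] 0 E = [tuple E; b; c]) *
  (set_slot [tuple a; b; c] 1 E = [tuple a; E; c]) *
  (set_slot [tuple a; b; c] 2%:R E = [tuple a; b; E]).
Proof.
by do !split; apply: eq_from_tnth => -[[|[|[|//]]] ?]; rewrite tnth_mktuple.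
Qed.

(** * Partial connections in a local frame *)

Section Frames.
Context {R : realType} {M : manifold5 R} {S : spin_bundle M}.
Implicit Types (W : set M) (phi : frame S -> M -> spinor R 1).

Lemma sum_trans1 (j j' : frame S) x (t : 1.-tuple 'I_2) (F : 'I_2 -> R) :
  \sum_(u : 1.-tuple 'I_2) trans_coef j j' x t u * F (tnth u 0) =
  \sum_E trans j j' x (tnth t 0) E * F E.
Proof.
rewrite (reindex (fun E : 'I_2 => [tuple E])) /=; last first.
  exists (fun u : 1.-tuple 'I_2 => tnth u 0) => [//|u _].
  by rewrite tuple1_eta.
by apply: eq_bigr => E _; rewrite /trans_coef big_ord1.
Qed.

(** For spinors of weight 0 the determinant disappears from the transformation
    law, which becomes that of the components of a vector. *)
Lemma tensor_section1P W phi :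
  tensor_section 0 W phi <->
  (forall j t, smooth_on (W `&` fdom j) (fun x => phi j x t)) /\
  (forall j j' x, W x -> fdom j x -> fdom j' x -> forall t,
     phi j x t = \sum_E trans j j' x (tnth t 0) E * phi j' x [tuple E]).
Proof.
have sumE j j' x t : (\det (trans j j' x)) `^ 0 *
      (\sum_u trans_coef j j' x t u * phi j' x u) =
    \sum_E trans j j' x (tnth t 0) E * phi j' x [tuple E].
  rewrite powRr0 mul1r -(sum_trans1 _ _ _ _ (fun E => phi j' x [tuple E])).
  by apply: eq_bigr => u _; rewrite tuple1_eta.
by split=> -[sm tr]; split=> // j j' x Wx jx j'x t;
  rewrite (tr j j') // sumE.
Qed.

Lemma tensor_section_sub k w W W' (psi : frame S -> M -> spinor R k) :
  W' `<=` W -> tensor_section w W psi -> tensor_section w W' psi.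
Proof.
move=> sW [sm tr]; split=> [j t|j j' x /sW Wx]; last exact: tr.
by apply: smooth_on_sub (sm j t) => x [/sW Wx jx].
Qed.

Lemma tensor_section_ext k w W (psi psi' : frame S -> M -> spinor R k) :
  open W ->
  (forall j x, W x -> fdom j x -> forall t, psi j x t = psi' j x t) ->
  tensor_section w W psi -> tensor_section w W psi'.
Proof.
move=> oW e [sm tr]; split=> [j t|j j' x Wx jx j'x t].
  apply: smooth_on_ext (sm j t); first by apply: openI => //; exact: fdom_open.
  by move=> x [Wx jx]; exact: e.
rewrite -e // (tr j j') //; congr (_ * _).
by apply: eq_bigr => u _; rewrite e.
Qed.

Lemma frame_section_tensor (j : frame S) (E : 'I_2) :
  tensor_section 0 (fdom j) (frame_section j E).
Proof.
apply/tensor_section1P; split=> [j' t|j' j'' x jx j'x j''x t].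
  by rewrite setIC; exact: trans_smooth.
rewrite /frame_section -(trans_cocycle j'x j''x jx) mxE.
by apply: eq_bigr => E' _.
Qed.

Lemma scale_section W phi (f : M -> R) : open W -> smooth_on W f ->
  tensor_section 0 W phi -> tensor_section 0 W (fun j y t => f y * phi j y t).
Proof.
move=> oW sf /tensor_section1P[sm tr].
apply/tensor_section1P; split=> [j t|j j' x Wx jx j'x t].
  apply: smooth_onM (sm j t); first by apply: openI => //; exact: fdom_open.
  by apply: smooth_on_sub sf => x [].
by rewrite (tr j j') // mulr_sumr; apply: eq_bigr => E _; rewrite mulrCA.
Qed.

Context {H : contact M} {G : g2_contact H S} {kap : chart M -> frame S -> M -> R}.

(** Over the domain of the frame j, phi = phi_0 s^0 + phi_1 s^1, and locality,
    linearity and the Leibniz rule compute nabla phi from nabla s^0, nabla s^1. *)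
Lemma partial_connection_frame nab W phi j x
    (s : 3.-tuple 'I_2) (t : 1.-tuple 'I_2) :
  partial_connection G kap nab -> open W -> tensor_section 0 W phi ->
  W x -> fdom j x ->
  nab phi j x [tuple of s ++ t] = induced G kap nab 0 phi j x s t.
Proof.
move=> pc oW sphi Wx jx.
pose W' := W `&` fdom j.
have oW' : open W' by apply: openI => //; exact: fdom_open.
have W'x : W' x by [].
pose f E y := phi j y [tuple E].
have sf E : smooth_on W' (f E) by case: sphi => sm _; exact: sm.
have ss E : tensor_section 0 W' (frame_section j E)
  by apply: tensor_section_sub (frame_section_tensor j E) => y [].
pose fs E := fun (j' : frame S) y t => f E y * frame_section j E j' y t.
have sfs E : tensor_section 0 W' (fs E) by exact: scale_section.
have sphi' : tensor_section 0 W' phi by apply: tensor_section_sub sphi => y [].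
pose phi' := fun (j' : frame S) y t => 1 * fs 0 j' y t + fs 1 j' y t.
have phiE j' y : W' y -> fdom j' y -> forall t, phi j' y t = phi' j' y t.
  move=> W'y j'y u; have [_ tr] := (tensor_section1P _ _).1 sphi'.
  rewrite (tr j' j) //; last by case: W'y.
  by rewrite sum2 /phi' /fs mul1r /f /frame_section; congr (_ + _); rewrite mulrC.
have sphi'' : tensor_section 0 W' phi' by exact: tensor_section_ext phiE sphi'.
rewrite (pc_local pc oW' sphi' sphi'' phiE) //.
rewrite (pc_linear pc _ oW' (sfs 0) (sfs 1)) // mul1r.
rewrite !(pc_Leibniz pc oW' (ss _) (sf _)) //.
rewrite /induced mul0r mul0r addr0 big_ord1 sum2.
have setE E : set_slot t ord0 E = [tuple E].
  by apply: eq_from_tnth => a; rewrite [a]ord1 tnth_mktuple.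
rewrite !setE /Gamma tuple1_eta.
rewrite /frame_section !(trans_id jx).
have -> : dH G kap j (fun y => phi j y t) x s = dH G kap j (f (tnth t 0)) x s.
  by rewrite /f tuple1_eta.
rewrite !mxE.
have [->|->] : tnth t 0 = 0 \/ tnth t 0 = 1.
- by case: (tnth t 0) => -[|[|//]] ?; [left|right]; apply: val_inj.
- by rewrite /f /=; ring.
- by rewrite /f /=; ring.
Qed.
End Frames.

(** * The difference of two partial connections *)

Section Torsion.
Context {R : realType} {M : manifold5 R} {H : contact M} {S : spin_bundle M}.
Context {G : g2_contact H S} {kap : chart M -> frame S -> M -> R}.

(** The action of dl_{ABC D}^E, an End S-valued 1-form on H, on the k-th tensor
    power of S with weight w. *)
Definition gl_action (dl : 3.-tuple 'I_2 -> 'I_2 -> 'I_2 -> R) (k : nat) (w : R)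
    (psi : spinor R k) (s : 3.-tuple 'I_2) (t : k.-tuple 'I_2) : R :=
  \sum_(a < k) \sum_E dl s (tnth t a) E * psi (set_slot t a E)
  + w * (\sum_E dl s E E) * psi t.

Lemma induced_sub nab nab' k w (psi : frame S -> M -> spinor R k) j x s t :
  induced G kap nab w psi j x s t - induced G kap nab' w psi j x s t =
  gl_action (fun s D E => Gamma nab j x s D E - Gamma nab' j x s D E)
    w (psi j x) s t.
Proof.
rewrite /induced /gl_action sumrB.
under [in RHS]eq_bigr do under eq_bigr do rewrite mulrBl.
under [in RHS]eq_bigr do rewrite sumrB.
by rewrite sumrB; ring.
Qed.

(** Near any point the contact structure is defined by a nowhere vanishing form,
    which the normalisation of kap would force to vanish together with kap. *)
Lemma kap_neq0 i j x : density_iso G kap -> dom i x -> fdom j x ->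
  kap i j x != 0.
Proof.
move=> hk ix jx; have [W [al [lal Wx alP]]] := ctH_contact H ix.
have Lal : L_section H i W al.
  by split=> // y Wy v; have [_ + _] := alP y Wy => ->.
have [lam lamE] := g2Y_Levi G Lal Wx jx.
have [al0 _ _] := alP x Wx.
apply: contra_neq al0 => k0; apply/rowP => a.
have := hk i j W al x lam Lal Wx jx lamE (delta_mx 0 a).
rewrite k0 expr0n mul0r mul0r mxE => <-.
rewrite /ev (bigD1 a) //= mxE !eqxx mulr1 big1 ?addr0// => b ba.
by rewrite mxE (negPf ba) andbF mulr0.
Qed.

Lemma local_form_cst (i : chart M) (c : 'rV[R]_5) : local_form i (dom i) (fun=> c).
Proof. by split=> // [|a]; [exact: dom_open|exact: smooth_on_cst]. Qed.

Lemma restrictH_onto i j x (om : spinor R 3) :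
  density_iso G kap -> dom i x -> fdom j x -> slot_symmetric om ->
  exists c : 'rV[R]_5, restrictH G kap i (fun=> c) j x = om.
Proof.
move=> hk ix jx som; have k0 := kap_neq0 hk ix jx.
have ev_Z c (a : R) v : ev c (a *: v) = a * ev c v.
  by rewrite /ev mulr_sumr; apply: eq_bigr => b _; rewrite mxE mulrCA.
have [|c cE] := g2Y_surj G ix jx (psi := fun t => (kap i j x ^+ 2)^-1 * om t).
  by move=> t p; rewrite som.
exists c; apply/funext => t.
by rewrite /restrictH /g2X ev_Z cE mulVKf // expf_neq0.
Qed.

Lemma Gamma_sym nab j x D E : partial_connection G kap nab -> fdom j x ->
  slot_symmetric (fun s => Gamma nab j x s D E).
Proof.
move=> pc jx.
exact: (pc_sym pc (fdom_open j) (frame_section_tensor j E) jx jx [tuple D]).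
Qed.

Lemma sym4_perpB (psi psi' : spinor R 4) s t :
  sym4_perp psi s t - sym4_perp psi' s t = sym4_perp (fun u => psi u - psi' u) s t.
Proof.
rewrite /sym4_perp -mulrBr -sumrB; congr (_ * _); apply: eq_bigr => p _.
by rewrite -sumrB; apply: eq_bigr => q _; rewrite mulrBl.
Qed.

Lemma contract7B (tau tau' : spinor R 7) (om : spinor R 3) u :
  contract7 tau om u - contract7 tau' om u =
  contract7 (fun t => tau t - tau' t) om u.
Proof.
rewrite /contract7 -sumrB; apply: eq_bigr => v _.
by rewrite -sumrB; apply: eq_bigr => r _; rewrite !mulrBl.
Qed.

(** The two torsion conditions are subtracted on 1-forms with constant coefficients
    taking a prescribed value at x.  The derivatives of omega and the Rumin
    operator cancel, and c eps3 is the Levi trace that the projection to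
    Lambda^2_{H perp} removes. *)
Lemma torsion_sub nab nab' j x :
  density_iso G kap -> torsion_in_Sym7 G kap nab -> torsion_in_Sym7 G kap nab' ->
  fdom j x ->
  let act om := gl_action
    (fun s D E => Gamma nab j x s D E - Gamma nab' j x s D E) (- 2) om in
  exists2 tau : spinor R 7, slot_symmetric tau &
    forall om, slot_symmetric om -> exists c, forall s t,
      act om s t - act om t s = sym4_perp (contract7 tau om) s t + c * eps3 R s t.
Proof.
move=> hk tor tor' jx act; set i := chart_at x; have ix := chart_atP x.
have [tau stau tauE] := tor i j x ix jx.
have [tau' stau' tauE'] := tor' i j x ix jx.
exists (fun t => tau t - tau' t) => [t p|om som]; first by rewrite stau stau'.
have [c cE] := restrictH_onto hk ix jx som.
have lc := local_form_cst i c.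
set omc := restrictH G kap i (fun=> c) in cE.
pose skew nab0 s t := induced G kap nab0 (- 2) omc j x s t
                      - induced G kap nab0 (- 2) omc j x t s.
exists ((trace_Levi (skew nab) - trace_Levi (skew nab')) / trace_Levi (@eps3 R)).
move=> s t.
have := congr2 (fun a b => a - b) (tauE _ _ lc ix s t) (tauE' _ _ lc ix s t).
rewrite sym4_perpB (_ : (fun u => _ - _) =
  contract7 (fun t => tau t - tau' t) (omc j x)); last first.
  by apply/funext => u; rewrite contract7B.
rewrite cE => <-.
rewrite /nabla_perp /perp -/(skew nab) -/(skew nab').
rewrite /act -cE -!(@induced_sub nab nab' 3 (- 2) omc) /skew; ring.
Qed.
End Torsion.

(** * Symmetric spinors *)

(** A permutation p is determined by p k and by the bijection it induces between
    the complements of k and p k. *)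
Lemma big_perm_lift (V : nmodType) n (k : 'I_n.+1) (F : 'S_n.+1 -> V) :
  \sum_p F p = \sum_i \sum_(q : 'S_n) F (lift_perm k i q).
Proof.
rewrite pair_big /= (reindex (fun u : 'I_n.+1 * 'S_n => lift_perm k u.1 u.2)) //=.
apply: onW_bij; apply: inj_card_bij; last first.
  by rewrite card_prod card_ord !card_Sn.
move=> [i q] [i' q'] /= e.
have ii' : i = i' by rewrite -(lift_perm_id k i q) e lift_perm_id.
rewrite -{i'}ii' in e *; congr (_, _); apply/permP => a.
by apply: (@lift_inj _ i); rewrite -!(lift_perm_lift k) e.
Qed.

Definition drop_slot n (t : n.+1.-tuple 'I_2) (i : 'I_n.+1) : n.-tuple 'I_2 :=
  [tuple tnth t (lift i a) | a < n].

Lemma big_slot_perm_lift (V : nmodType) n (t : n.+1.-tuple 'I_2)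
    (F : n.+1.-tuple 'I_2 -> V) :
  \sum_(p : 'S_n.+1) F (slot_perm t p) =
  \sum_i \sum_(q : 'S_n)
    F [tuple of tnth t i :: slot_perm (drop_slot t i) q].
Proof.
rewrite (big_perm_lift ord0); apply: eq_bigr => i _; apply: eq_bigr => q _.
congr F; apply: eq_from_tnth => a; rewrite tnth_mktuple.
case: (unliftP ord0 a) => [b|] ->; last by rewrite lift_perm_id.
by rewrite lift_perm_lift tnthS !tnth_mktuple.
Qed.

Definition sum6 (V : nmodType) (F : 'I_2 -> 'I_2 -> 'I_2 -> V) a b c : V :=
  F a b c + F a c b + (F b a c + F b c a) + (F c a b + F c b a).

Lemma big_slot_perm3 (V : nmodType) (F : 3.-tuple 'I_2 -> V) a b c :
  \sum_(p : 'S_3) F (slot_perm [tuple a; b; c] p) =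
  sum6 (fun a b c => F [tuple a; b; c]) a b c.
Proof.
have S1 (G : 1.-tuple 'I_2 -> V) t : \sum_(p : 'S_1) G (slot_perm t p) = G t.
  rewrite (big_pred1 1%g) => [|q]; last first.
    by apply/esym/eqP/permP => i; rewrite [LHS]ord1 [RHS]ord1.
  by congr G; apply: eq_from_tnth => i; rewrite tnth_mktuple perm1.
have drop2 x y : (drop_slot [tuple x; y] ord0 = [tuple y]) *
    (drop_slot [tuple x; y] (lift ord0 ord0) = [tuple x]).
  by split; apply: eq_from_tnth => i; rewrite tnth_mktuple [i]ord1.
have drop3 x y z : (drop_slot [tuple x; y; z] ord0 = [tuple y; z]) *
    (drop_slot [tuple x; y; z] (lift ord0 ord0) = [tuple x; z]) *
    (drop_slot [tuple x; y; z] (lift ord0 (lift ord0 ord0)) = [tuple x; y]).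
  by do !split; apply: eq_from_tnth => -[[|[|//]] ?]; rewrite tnth_mktuple.
have S2 (G : 2.-tuple 'I_2 -> V) x y :
    \sum_(p : 'S_2) G (slot_perm [tuple x; y] p) = G [tuple x; y] + G [tuple y; x].
  rewrite big_slot_perm_lift !big_ord_recl big_ord0 addr0 !drop2.
  rewrite !(S1 (fun u => G [tuple of _ :: u])).
  by congr (G _ + G _); exact: val_inj.
rewrite big_slot_perm_lift !big_ord_recl big_ord0 addr0 !drop3.
rewrite !(S2 (fun u => F [tuple of _ :: u])) addrA.
by rewrite /sum6; do !congr (_ + _); congr F; exact: val_inj.
Qed.

Lemma big_tuple3 (V : nmodType) (F : 3.-tuple 'I_2 -> V) :
  \sum_t F t = \sum_a \sum_b \sum_c F [tuple a; b; c].
Proof.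
under [RHS]eq_bigr do rewrite pair_bigA.
rewrite pair_bigA.
rewrite (reindex (fun u : 'I_2 * ('I_2 * 'I_2) => [tuple u.1; u.2.1; u.2.2])) //=.
exists (fun t => (tnth t 0, (tnth t 1, tnth t 2%:R))) => [[a [b c]] _ //|t _] /=.
by apply: eq_from_tnth => -[[|[|[|//]]] i]; rewrite [LHS](tnth_nth 0) /=;
  congr tnth; exact: val_inj.
Qed.

Lemma perm_eq_slot_perm n (t : n.-tuple 'I_2) (p : 'S_n) :
  perm_eq (slot_perm t p) t.
Proof. by apply/tuple_permP; exists p. Qed.

(** The indices take two values, so a multiset of n of them is given by its number
    of ones. *)
Lemma slot_symmetric_count (R : realType) n (T : spinor R n) :
  slot_symmetric T -> exists m : nat -> R, forall t, T t = m (ones t).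
Proof.
move=> sT.
exists (fun k => if [pick t : n.-tuple 'I_2 | ones t == k] is Some t
                 then T t else 0) => t.
case: pickP => [u /eqP ut|/(_ t)]; last by rewrite eqxx.
have c0 (v : n.-tuple 'I_2) : count_mem (0 : 'I_2) v = (n - ones v)%N.
  have sz : (ones v + count_mem (0%R : 'I_2) v)%N = n.
    rewrite -[RHS](size_tuple v) -(count_predC (pred1 (1 : 'I_2)) v).
    by congr addn; apply: eq_count => -[[|[|//]] ?].
  by rewrite -[LHS](addKn (ones v)) sz.
suff /tuple_permP[p tE] : perm_eq t u.
  by rewrite -(sT u p); congr T; apply: val_inj.
apply/allP => a _ /=; have [->|->] : a = 0 \/ a = 1.
  by case: a => -[|[|//]] ?; [left|right]; apply: val_inj.
- by rewrite !c0 ut.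
- by rewrite ut.
Qed.

Lemma count_slot_symmetric (R : realType) n (m : nat -> R) :
  slot_symmetric (fun t : n.-tuple 'I_2 => m (ones t)).
Proof. by move=> t p; have /seq.permP -> := perm_eq_slot_perm t p. Qed.

Section Eval.
Variable R : realType.
Local Notation e := (eps R).

Lemma epsE : (e 0 0 = 0) * (e 0 1 = 1) * (e 1 0 = -1) * (e 1 1 = 0).
Proof. by rewrite /eps /= !subrr subr0 sub0r. Qed.

Lemma gl_action3E dl w (om : spinor R 3) s a b c :
  gl_action dl w om s [tuple a; b; c] =
  \sum_E (dl s a E * om [tuple E; b; c] + dl s b E * om [tuple a; E; c]
          + dl s c E * om [tuple a; b; E])
  + w * (\sum_E dl s E E) * om [tuple a; b; c].
Proof.
rewrite /gl_action exchange_big; congr (_ + _); apply: eq_bigr => E _.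
rewrite !big_ord_recl big_ord0 /= addr0 addrA.
by do 2?[congr (_ + _)]; congr (_ * om _);
  apply: eq_from_tnth => -[[|[|[|//]]] ?]; rewrite tnth_mktuple.
Qed.

Lemma gl_action1E dl w (phi : spinor R 1) s D :
  gl_action dl w phi s [tuple D] =
  \sum_E dl s D E * phi [tuple E] + w * (\sum_E dl s E E) * phi [tuple D].
Proof.
rewrite /gl_action big_ord1; congr (_ + _); apply: eq_bigr => E _.
by congr (_ * phi _); apply: eq_from_tnth => a; rewrite [a]ord1 tnth_mktuple.
Qed.

Lemma eps3E a b c a' b' c' :
  eps3 R [tuple a; b; c] [tuple a'; b'; c'] =
  6^-1 * sum6 (fun a' b' c' => e a a' * e b b' * e c c') a' b' c'.
Proof.
rewrite /eps3 (big_slot_perm3 (fun t => \prod_(i < 3) e (tnth _ i) (tnth t i))).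
by rewrite /sum6 !big_ord_recl !big_ord0 !mulr1 !mulrA.
Qed.

Lemma sym4_perpE psi a b c a' b' c' :
  sym4_perp psi [tuple a; b; c] [tuple a'; b'; c'] =
  6^-1 ^+ 2 * sum6 (fun a b c => sum6 (fun a' b' c' =>
    psi [tuple a; b; a'; b'] * e c c') a' b' c') a b c.
Proof.
rewrite /sym4_perp; congr (_ * _).
rewrite (big_slot_perm3 (fun s => \sum_(q : 'S_3)
    let t := slot_perm [tuple a'; b'; c'] q in
    psi [tuple tnth s 0; tnth s 1; tnth t 0; tnth t 1] *
    e (tnth s 2%:R) (tnth t 2%:R))).
congr (sum6 _ a b c); apply/funext=> {}a; apply/funext => {}b; apply/funext => {}c.
exact: (big_slot_perm3 (fun t =>
    psi [tuple a; b; tnth t 0; tnth t 1] * e c (tnth t 2%:R))).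
Qed.

Lemma prod_eps3 a b c a' b' c' :
  \prod_(i < 3) e (tnth [tuple a; b; c] i) (tnth [tuple a'; b'; c'] i) =
  e a a' * e b b' * e c c'.
Proof. by rewrite !big_ord_recl big_ord0 mulr1 !mulrA. Qed.

(** Raising the indices with eps exchanges zeros and ones, with a sign for each one. *)
Lemma raise3E (m : nat -> R) (v : 3.-tuple 'I_2) :
  \sum_(r : 3.-tuple 'I_2) \prod_(i < 3) e (tnth v i) (tnth r i) * m (ones r) =
  (- 1) ^+ ones v * m (3 - ones v)%N.
Proof.
rewrite [v]tuple3_eta; move: (tnth v _) (tnth v _) (tnth v _) => c b a.
rewrite big_tuple3; move: a b c.
elim/ord2P; elim/ord2P; elim/ord2P.
all: under eq_bigr do under eq_bigr do under eq_bigr do rewrite prod_eps3.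
all: rewrite !sum2 !epsE /=.
all: ring.
Qed.

Lemma contract7E (tau : spinor R 7) (mt m : nat -> R) (u : 4.-tuple 'I_2) :
  (forall t, tau t = mt (ones t)) ->
  let n := ones u in
  contract7 tau (fun t => m (ones t)) u =
  mt n * m 3%N - 3 * mt n.+1 * m 2%N + 3 * mt n.+2 * m 1%N - mt n.+3 * m 0%N.
Proof.
move=> tauE n.
rewrite /contract7.
under eq_bigr => v _.
  under eq_bigr do rewrite -mulrA tauE /= count_cat.
  rewrite -mulr_sumr raise3E.
  over.
rewrite big_tuple3 !sum2 /= -/n.
rewrite !(addn0, add0n, addn1, addnS); ring.
Qed.
End Eval.

(** * The partial torsion determines the connection up to a trace *)

Section Algebra.
Variable R : realType.
Local Notation e := (eps R).

(** The component (dl_s om)_t of the action of dl on Sym^3 S[-2], for s with k ones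
    and t with n ones, when dl and om have components d and m: of the slots of t,
    3 - n contain 0 and n contain 1.  These factors vanish where n.+1 or n.-1 leaves
    the range 0..3. *)
Definition gl_weight (d : 'I_2 -> 'I_2 -> nat -> R) (m : nat -> R)
    (k n : nat) : R :=
  (3 - n%:R) * (d 0 0 k * m n + d 0 1 k * m n.+1)
  + n%:R * (d 1 0 k * m n.-1 + d 1 1 k * m n) - 2 * (d 0 0 k + d 1 1 k) * m n.

(** The skew part of dl om equals psi in Sym^4 S[-3], written for the five
    trace-free components of a 2-form.  The third adds to the component (000, 111)
    three times the component (001, 011): on these eps3 is 1 and -1/3, so that the
    combination is free of the Levi trace. *)
Definition weight_equations (d : 'I_2 -> 'I_2 -> nat -> R) (m psi : nat -> R) :
    Prop :=
  [/\ 3 * (gl_weight d m 0 1 - gl_weight d m 1 0) = psi 0%N,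
      3 * (gl_weight d m 0 2 - gl_weight d m 2 0) = 2 * psi 1%N,
      (gl_weight d m 0 3 - gl_weight d m 3 0)
        + 3 * (gl_weight d m 1 2 - gl_weight d m 2 1) = 2 * psi 2%N,
      3 * (gl_weight d m 1 3 - gl_weight d m 3 1) = 2 * psi 3%N &
      3 * (gl_weight d m 2 3 - gl_weight d m 3 2) = psi 4%N].

(** The five combinations eliminate c, because eps3 vanishes on a pair s, t in which
    the total number of ones is not 3. *)
Lemma torsion_equations (d : 'I_2 -> 'I_2 -> nat -> R) (m psi : nat -> R) (c : R) :
  let om : spinor R 3 := fun t => m (ones t) in
  let act := gl_action (fun s D E => d D E (ones s)) (- 2) om in
  (forall s t, act s t - act t s =
     sym4_perp (fun u => psi (ones u)) s t + c * eps3 R s t) ->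
  weight_equations d m psi.
Proof.
move=> om act tor.
have {tor} tor a b c' a' b' c'' := tor [tuple a; b; c'] [tuple a'; b'; c''].
have tor01 := tor 0 0 0 0 0 1.
have tor02 := tor 0 0 0 0 1 1.
have tor03 := tor 0 0 0 1 1 1.
have tor12 := tor 0 0 1 0 1 1.
have tor13 := tor 0 0 1 1 1 1.
have tor23 := tor 0 1 1 1 1 1.
move: tor01 tor02 tor03 tor12 tor13 tor23 => {tor}.
rewrite /act !gl_action3E !sum2 /om !sym4_perpE !eps3E /sum6 !epsE /=.
rewrite !(add0n, addn0) /weight_equations /gl_weight /=.
move=> tor01 tor02 tor03 tor12 tor13 tor23.
by split; lra.
Qed.

(** Here psi is the contraction of the Sym^7 spinor mt with om, and om runs through
    the basis of Sym^3.  The diagonal torus of GL_2 splits the system: a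
    component d D E n has weight n + D - E, and the equation from a pair with r ones
    in all and the i-th basis element has weight r - i.  Each component is
    found from the equations of its own weight, of which there are at most four. *)
Lemma weight_solution (d : 'I_2 -> 'I_2 -> nat -> R) (mt : nat -> R) :
  (forall k, let m n := (n == k)%:R in weight_equations d m (fun n =>
     mt n * m 3%N - 3 * mt n.+1 * m 2%N + 3 * mt n.+2 * m 1%N - mt n.+3 * m 0%N)) ->
  let U n := d 0 0 n + d 1 1 n in
  forall n, (n <= 3)%N ->
  [/\ 3 * d 0 0 n = n%:R * U n, 3 * d 0 1 n = - n%:R * U n.-1,
      3 * d 1 0 n = - (3 - n%:R) * U n.+1 & 3 * d 1 1 n = (3 - n%:R) * U n].
Proof.
rewrite /weight_equations /gl_weight => eqs n n3.
(* The hypothesis named E, i, r is the equation of weight r - i. *)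
have /= [E01 E02 E03 E04 E05] := eqs 0%N.
have /= [E11 E12 E13 E14 E15] := eqs 1%N.
have /= [E21 E22 E23 E24 E25] := eqs 2%N.
have /= [E31 E32 E33 E34 E35] := eqs 3%N.
case: n n3 => [|[|[|[|//]]]] _ /=; split.
- by clear - E11 E22 E33; lra.
- by clear - E21 E32; lra.
- by clear - E01 E12 E23 E34; lra.
- by clear - E11 E22 E33; lra.
- by clear - E01 E12 E23 E34; lra.
- by clear - E11 E22 E33; lra.
- by clear - E02 E13 E24 E35; lra.
- by clear - E01 E12 E23 E34; lra.
- by clear - E02 E13 E24 E35; lra.
- by clear - E01 E12 E23 E34; lra.
- by clear - E03 E14 E25; lra.
- by clear - E02 E13 E24 E35; lra.
- by clear - E03 E14 E25; lra.
- by clear - E02 E13 E24 E35; lra.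
- by clear - E04 E15; lra.
- by clear - E03 E14 E25; lra.
Qed.

(** This says that dl_{ABC D}^E = Y_{(AB}^E eps_{C)D} with Y_{ABC} = dl_{ABC E}^E:
    the only part of dl that the torsion modulo Sym^7 does not see is the copy of
    Sym^3 embedded in this way, in which the trace is Y itself. *)
Lemma connection_change (dl : 3.-tuple 'I_2 -> 'I_2 -> 'I_2 -> R) :
  (forall D E, slot_symmetric (fun s => dl s D E)) ->
  (exists2 tau : spinor R 7, slot_symmetric tau &
    forall om : spinor R 3, slot_symmetric om -> exists c, forall s t,
      gl_action dl (- 2) om s t - gl_action dl (- 2) om t s =
      sym4_perp (contract7 tau om) s t + c * eps3 R s t) ->
  forall s D E,
    dl s D E = 3^-1 * \sum_(a < 3) \sum_F
      e (tnth s a) D * e F E * \sum_B dl (set_slot s a F) B B.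
Proof.
move=> sdl [tau stau tor].
have [d dE] : exists d : 'I_2 -> 'I_2 -> nat -> R,
    forall s D E, dl s D E = d D E (ones s).
  have [d dE] := choice (fun DE => slot_symmetric_count (sdl DE.1 DE.2)).
  by exists (fun D E => d (D, E)) => s D E; rewrite (dE (D, E)).
have [mt mtE] := slot_symmetric_count stau.
pose m (k n : nat) : R := (n == k)%:R.
pose psi k n :=
  mt n * m k 3%N - 3 * mt n.+1 * m k 2%N + 3 * mt n.+2 * m k 1%N
    - mt n.+3 * m k 0%N.
have {sdl} {}tor k : exists c, forall s t,
    let act := gl_action (fun s D E => d D E (ones s)) (- 2)
                         (fun t : 3.-tuple 'I_2 => m k (ones t)) in
    act s t - act t s = sym4_perp (fun u => psi k (ones u)) s t + c * eps3 R s t.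
  have [c cE] := tor _ (@count_slot_symmetric R 3 (m k)).
  exists c => s t /=; rewrite (_ : (fun s D E => _) = dl); last first.
    by apply/funext => ?; apply/funext => D; apply/funext => E; rewrite dE.
  rewrite cE; congr (sym4_perp _ _ _ + _); apply/funext => u.
  exact: contract7E.
have {tor} eqs k : weight_equations d (m k) (psi k).
  by have [c /torsion_equations] := tor k.
have sol n := weight_solution eqs (n := n).
have /= [a0 b0 c0 d0] := sol 0%N isT.
have /= [a1 b1 c1 d1] := sol 1%N isT.
have /= [a2 b2 c2 d2] := sol 2%N isT.
have /= [a3 b3 c3 d3] := sol 3%N isT.
move=> s D E; rewrite [s]tuple3_eta; move: (tnth _ _) (tnth _ _) (tnth _ _).
move=> C B A; rewrite sum3 /= !sum2 !set_slot3 !dE /=.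
rewrite (_ : tnth [tuple A; B; C] 0 = A) // (_ : tnth [tuple A; B; C] 1 = B) //.
rewrite (_ : tnth [tuple A; B; C] 2%:R = C) //.
elim/ord2P: A; elim/ord2P: B; elim/ord2P: C; elim/ord2P: D; elim/ord2P: E.
all: rewrite !epsE /= !(add0n, addn0, add1n).
all: clear - a0 b0 c0 d0 a1 b1 c1 d1 a2 b2 c2 d2 a3 b3 c3 d3.
all: lra.
Qed.
End Algebra.

(** * The two operators *)

Section Operators.
Variable R : realType.
Local Notation e := (eps R).

Lemma sum_slot_perm_skew n (T : spinor R n) (a b : 'I_n) :
  (forall t, T (slot_perm t (tperm a b)) = - T t) ->
  forall t, \sum_p T (slot_perm t p) = 0.
Proof.
move=> skT t; suff sT : \sum_p T (slot_perm t p) = - \sum_p T (slot_perm t p) by lra.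
rewrite [LHS](reindex_inj (mulgI (tperm a b))) -sumrN.
apply: eq_bigr => p _; rewrite -skT; congr T.
by apply: eq_from_tnth => i; rewrite !tnth_mktuple permM.
Qed.

Definition front (u : 4.-tuple 'I_2) : 3.-tuple 'I_2 :=
  [tuple tnth u (lshift 1 a) | a < 3].

Lemma front_last (u : 4.-tuple 'I_2) :
  u = [tuple of front u ++ [tuple tnth u (rshift 3 ord0)]].
Proof.
apply: (@eq_from_tnth (3 + 1)) => i; case: (split_ordP i) => a ->.
  by rewrite tnth_lshift tnth_mktuple.
by rewrite tnth_rshift [a]ord1.
Qed.

Variable dl : 3.-tuple 'I_2 -> 'I_2 -> 'I_2 -> R.
Hypothesis sdl : forall D E, slot_symmetric (fun s => dl s D E).
Hypothesis dlE : forall s D E,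
  dl s D E = 3^-1 * \sum_(a < 3) \sum_F
    e (tnth s a) D * e F E * \sum_B dl (set_slot s a F) B B.

(** Each term of the formula for dl contains eps between one of the slots ABC and
    the slot D, and is skew in these two. *)
Lemma twistor_change (phi : spinor R 1) :
  symmetrise (fun u => gl_action dl 0 phi (front u) [tuple tnth u (rshift 3 ord0)]) =
  fun=> 0.
Proof.
apply/funext => t; rewrite /symmetrise.
pose T (a : 'I_3) (u : 4.-tuple 'I_2) : R :=
  e (tnth u (lshift 1 a)) (tnth u (rshift 3 ord0)) *
  \sum_E \sum_F e F E * (\sum_B dl (set_slot (front u) a F) B B) * phi [tuple E].
have TE u : gl_action dl 0 phi (front u) [tuple tnth u (rshift 3 ord0)] =
    3^-1 * \sum_a T a u.
  rewrite gl_action1E !mul0r addr0.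
  under eq_bigr do rewrite dlE -mulrA.
  rewrite -mulr_sumr; congr (_ * _).
  under eq_bigr do rewrite mulr_suml.
  rewrite exchange_big; apply: eq_bigr => a _.
  rewrite /T mulr_sumr; apply: eq_bigr => E _.
  rewrite mulr_suml mulr_sumr; apply: eq_bigr => F _.
  by rewrite tnth_mktuple !mulrA.
under eq_bigr do rewrite TE.
rewrite -mulr_sumr exchange_big big1 ?mulr0// => a _.
apply: (@sum_slot_perm_skew _ _ (lshift 1 a) (rshift 3 ord0)) => u.
have frontE F :
    set_slot (front (slot_perm u (tperm (lshift 1 a) (rshift 3 ord0)))) a F
    = set_slot (front u) a F.
  apply: eq_from_tnth => b; rewrite !tnth_mktuple; case: eqVneq => // ba.
  by rewrite tpermD // ?eq_rlshift // eq_lshift eq_sym.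
rewrite /T !tnth_mktuple tpermL tpermR -mulNr; congr (_ * _).
  by rewrite /eps opprB.
by apply: eq_bigr => E _; apply: eq_bigr => F _; rewrite frontE.
Qed.

(** Contracting C with D in Y_{(AB}^E eps_{C)D} gives 2/3 Y_{AB}^E from eps_{CD} and
    1/3 Y_{AB}^E from each of eps_{AD} and eps_{BD}: the total 4/3 Y_{AB}^E is
    cancelled by the weight. *)
Lemma dirac_change (phi : spinor R 1) (A B : 'I_2) :
  \sum_C \sum_D
    e C D * gl_action dl (- (4 / 3)) phi [tuple A; B; C] [tuple D] = 0.
Proof.
have [|u uE] := @slot_symmetric_count R 3 (fun s => \sum_B dl s B B).
  by move=> s p; apply: eq_bigr => ? _; exact: sdl.
under eq_bigr do under eq_bigr do rewrite gl_action1E uE.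
have dE s D E : dl s D E = 3^-1 * \sum_(a < 3) \sum_F
    e (tnth s a) D * e F E * u (ones (set_slot s a F)).
  by rewrite dlE; under eq_bigr do under eq_bigr do rewrite uE.
rewrite !sum2 !epsE !dE !sum3 !sum2 !set_slot3.
elim/ord2P: A; elim/ord2P: B; rewrite /tnth /= !epsE !(add0n, addn0, add1n).
all: lra.
Qed.
End Operators.

Theorem mainTheorem3 (R : realType) (M : manifold5 R) (H : contact M)
    (S : spin_bundle M) (G : g2_contact H S)
    (kap : chart M -> frame S -> M -> R) (hkap : density_iso G kap)
    (sg sg' : frame S -> M -> spinor R 0)
    (hsg : is_scale sg) (hsg' : is_scale sg')
    (nab nab' : (frame S -> M -> spinor R 1) -> frame S -> M -> spinor R 4)
    (hnab : preferred G kap sg nab) (hnab' : preferred G kap sg' nab') :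
  (forall (W : set M) (phi : frame S -> M -> spinor R 1),
     open W -> tensor_section 0 W phi ->
     forall (j : frame S) (x : M), W x -> fdom j x ->
     forall t : 4.-tuple 'I_2,
       twistor_op nab phi j x t = twistor_op nab' phi j x t) /\
  (forall (W : set M) (phi : frame S -> M -> spinor R 1),
     open W -> tensor_section (- (4 / 3)) W phi ->
     forall (j : frame S) (x : M), W x -> fdom j x ->
     forall t : 2.-tuple 'I_2,
       dirac_op G kap nab (- (4 / 3)) phi j x t =
       dirac_op G kap nab' (- (4 / 3)) phi j x t).
Proof.
have [pc _ tor] := hnab; have [pc' _ tor'] := hnab'.
pose dl j x s D E := Gamma nab j x s D E - Gamma nab' j x s D E.
have sdl j x D E : fdom j x -> slot_symmetric (fun s => dl j x s D E).
  by move=> jx s p; rewrite /dl (Gamma_sym _ _ pc jx) (Gamma_sym _ _ pc' jx).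
have dlE j x : fdom j x -> forall s D E,
    dl j x s D E = 3^-1 * \sum_(a < 3) \sum_F
      eps R (tnth s a) D * eps R F E * \sum_B dl j x (set_slot s a F) B B.
  move=> jx; apply: connection_change => [D E|]; first exact: sdl.
  exact: (torsion_sub hkap tor tor' jx).
split=> W phi oW sphi j x Wx jx t.
  apply/eqP; rewrite -subr_eq0 /twistor_op /symmetrise -mulrBr -sumrB.
  apply/eqP; apply: etrans (congr1 (@^~ t) (twistor_change (dlE j x jx) (phi j x))).
  congr (_ * _); apply: eq_bigr => p _.
  rewrite [in LHS](front_last (slot_perm t p)).
  rewrite (partial_connection_frame _ _ pc oW sphi) //.
  by rewrite (partial_connection_frame _ _ pc' oW sphi) // induced_sub.
apply/eqP; rewrite -subr_eq0 /dirac_op -sumrB; apply/eqP.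
apply: etrans (dirac_change (fun D E => sdl j x D E jx) (dlE j x jx)
                 (phi j x) (tnth t 0) (tnth t 1)).
apply: eq_bigr => C _; rewrite -sumrB; apply: eq_bigr => D _.
by rewrite -mulrBr induced_sub.
Qed.
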